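(* Let $\phi_{\mathrm{xor}}$ be a conjunction of xor-constraints and let $\{X_1,\dots,X_n\}$ be the family of variable sets (bags) of a tree decomposition of the primal graph of $\phi_{\mathrm{xor}}$. Let $\phi_0,\dots,\phi_n$ be defined by $\phi_0=\phi_{\mathrm{xor}}$ and $\phi_i=\phi_{i-1}\land\mathrm{ptable}(X_i,\phi_{i-1},|X_i|)$ for $i\in\{1,\dots,n\}$. Then $\phi_n\setminus\phi_{\mathrm{xor}}$ is a GE-simulation formula for $\phi_{\mathrm{xor}}$ with $O(n2^{2k})+|\phi_{\mathrm{xor}}|$ xor-constraints, where $k=\max(|X_1|,\dots,|X_n|)$.
   Context: An xor-constraint is an equation $x_1\oplus\dots\oplus x_m\equiv p$ with Boolean variables and $p\in\{\bot,\top\}$; duplicates cancel; $x\equiv\top$ is the literal $x$, $x\equiv\bot$ is $\neg x$. For a set $Y'=\{y_1,\dots,y_m\}$ of variables, $(a\oplus Y'\equiv p)$ denotes $(a\oplus y_1\oplus\dots\oplus y_m\equiv p)$, and $Y_1\oplus Y_2$ denotes symmetric difference. Unit propagation: from $x\equiv\top$ (resp. $\bot$) and an xor-constraint $D$ containing $x$ infer $D$ with $x$ replaced by $\top$ (resp. $\bot$); $\psi\vdash_{\mathrm{UP}}E$ means $E$ is obtainable from $\psi$ by repeated such inferences. A conjunction $\psi$ is a GE-simulation formula for $\phi_{\mathrm{xor}}$ if (i) the satisfying assignments of $\phi_{\mathrm{xor}}$ are exactly those of $\phi_{\mathrm{xor}}\land\psi$ projected to $\mathrm{vars}(\phi_{\mathrm{xor}})$;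 (ii) if $\phi_{\mathrm{xor}}$ is satisfiable and $\phi_{\mathrm{xor}}\land l_1\land\dots\land l_r\models\hat l$ for literals $l_i,\hat l$, then $\phi_{\mathrm{xor}}\land\psi\land l_1\land\dots\land l_r\vdash_{\mathrm{UP}}\hat l$; (iii) if $\phi_{\mathrm{xor}}$ is unsatisfiable then $\phi_{\mathrm{xor}}\land\psi\vdash_{\mathrm{UP}}(\bot\equiv\top)$. The translation $\mathrm{ptable}(Y,\phi,k)$: start with $\phi'=\phi$. (1) For each nonempty $Y'\subseteq Y$ with $|Y'|\le k$: if no variable $a$ with $(a\oplus Y'\equiv\bot)$ in $\phi'$ exists, add $(a\oplus Y'\equiv\bot)$ for a new ''alias'' variable $a$; if $(Y'\equiv p)$ is in $\phi'$ and $(a\equiv p)$ is not, where $a$ is the alias of $Y'$, add $(a\equiv p)$. (2) For each pair of distinct nonempty $Y_1,Y_2\subseteq Y$ with $|Y_1|,|Y_2|\le k$: if some $a_3$ with $(a_3\oplus(Y_1\oplus Y_2)\equiv\bot)$ in $\phi'$ exists, let $a_1,a_2$ be the variables with $(a_1\oplus Y_1\equiv\bot)$, $(a_2\oplus Y_2\equiv\bot)$ in $\phi'$ and add $(a_1\oplus a_2\oplus a_3\equiv\bot)$ if not present. Return $\phi'\setminus\phi$. The primal graph of $\phi_{\mathrm{xor}}$ has the variables as vertices, with an edge between two variables iff they occur together in some xor-constraint. A tree decomposition of a graph $(V,E)$ is a tree whose nodes are subsets $X_1,\dots,X_n$ of $V$ with $V=\bigcup X_i$, every edge contained in some $X_i$,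 and for every vertex the nodes containing it form a connected subtree.
   Formalization: In (ii), if the assumed literals are inconsistent with satisfiable φ_xor, unit propagation must derive ⊥≡⊤ rather than every literal (false as stated: it has no ex falso); ''the alias'' of a set is one variable fixed across all ptable calls. *)

(* Defs.v *)
(* MathComp world, with finmap for finite sets over an infinite type. *)
From HB Require Import structures.
From mathcomp Require Import all_boot.
From mathcomp Require Import finmap.

Set Implicit Arguments.
Unset Strict Implicit.
Unset Printing Implicit Defensive.

Local Open Scope fset_scope.

Definition var := nat.

(* The pair (S, p) is the xor-constraint whose left-hand side is the sum of the
   variables in S and whose right-hand side is p (true for top).  Taking S to be
   a set amounts to keeping constraints in the normal form where duplicated
   variables have been cancelled and constants moved to the right. *)
Definition xorc : Type := ({fset var} * bool)%type.

Definition xorf : Type := {fset xorc}.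

Definition symdiff (A B : {fset var}) : {fset var} := (A `\` B) `|` (B `\` A).

Definition vars (phi : xorf) : {fset var} := \bigcup_(C <- phi) C.1.

Definition satc (tau : var -> bool) (C : xorc) : Prop :=
  \big[addb/false]_(x <- C.1) tau x = C.2.

Definition sat (tau : var -> bool) (phi : xorf) : Prop :=
  forall C, C \in phi -> satc tau C.

Definition satisfiable (phi : xorf) : Prop := exists tau, sat tau phi.

Definition entails (phi : xorf) (C : xorc) : Prop :=
  forall tau, sat tau phi -> satc tau C.

Definition lit (x : var) (p : bool) : xorc := ([fset x], p).

Definition lits (ls : seq (var * bool)) : xorf :=
  [fset lit l.1 l.2 | l in ls].

(* bot = top *)
Definition falsum : xorc := (fset0, true).

(* Replacing x by the constant b in (S, p) and moving b to the right-hand side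
   gives (S `\ x, p (+) b). *)
Inductive up (psi : xorf) : xorc -> Prop :=
| up_premise C : C \in psi -> up psi C
| up_propagate x b S p :
    up psi (lit x b) -> up psi (S, p) -> x \in S -> up psi (S `\ x, p (+) b).

(* Unit propagation has no ex falso rule: from contradictory assumptions it
   yields falsum, but not every literal.  The simulation of entailment for a
   satisfiable phi is therefore stated in two parts, according to whether the
   assumptions are consistent with phi (the literal itself is derived) or not
   (falsum is derived). *)
Record GE_simulation (phi psi : xorf) : Prop := {
  GE_models : forall tau : var -> bool,
    sat tau phi <->
    exists sigma, sat sigma (phi `|` psi) /\ {in vars phi, sigma =1 tau};
  GE_entail : satisfiable phi ->
    forall (ls : seq (var * bool)) (l : var * bool),
      satisfiable (phi `|` lits ls) ->
      entails (phi `|` lits ls) (lit l.1 l.2) ->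
      up (phi `|` psi `|` lits ls) (lit l.1 l.2);
  GE_conflict : satisfiable phi ->
    forall ls : seq (var * bool),
      ~ satisfiable (phi `|` lits ls) ->
      up (phi `|` psi `|` lits ls) falsum;
  GE_unsat : ~ satisfiable phi -> up (phi `|` psi) falsum
}.

Definition alias_def (a : var) (S : {fset var}) : xorc :=
  (symdiff [fset a] S, false).

Definition has_alias (phi : xorf) (S : {fset var}) : Prop :=
  exists a, alias_def a S \in phi.

Definition table_row (a1 a2 a3 : var) : xorc :=
  (symdiff [fset a1] (symdiff [fset a2] [fset a3]), false).

Section PTable.

(* [al S] is the variable referred to as "the alias" of S.  A formula may contain
   several variables a with [alias_def a S] in it; the alias is one of them, and
   the same one every time the alias of S is looked up, including in later calls
   on extensions of the formula.  When S has no alias yet, [al S] has to be a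
   new variable. *)
Variable al : {fset var} -> var.

Inductive find_alias (Y : {fset var}) (phi : xorf) (S : {fset var}) :
    xorf -> Prop :=
| Alias_found of alias_def (al S) S \in phi : find_alias Y phi S phi
| Alias_new of ~ has_alias phi S & al S \notin vars phi `|` Y :
    find_alias Y phi S (alias_def (al S) S |` phi).

Definition alias_step (Y : {fset var}) (S : {fset var}) (phi phi' : xorf) :=
  exists2 phi1, find_alias Y phi S phi1 &
    phi' = phi1 `|` [fset lit (al S) p | p in [:: false; true]
                                       & (S, p) \in phi1].

Inductive table_step (P : {fset var} * {fset var}) (phi : xorf) :
    xorf -> Prop :=
| Table_row of alias_def (al P.1) P.1 \in phi
             & alias_def (al P.2) P.2 \in phi
             & alias_def (al (symdiff P.1 P.2)) (symdiff P.1 P.2) \in phi :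
    table_step P phi
      (table_row (al P.1) (al P.2) (al (symdiff P.1 P.2)) |` phi)
| Table_skip of ~ has_alias phi (symdiff P.1 P.2) : table_step P phi phi.

Fixpoint run (A : Type) (step : A -> xorf -> xorf -> Prop) (s : seq A)
    (phi phi' : xorf) : Prop :=
  if s is x :: s' then exists2 phi1, step x phi phi1 & run step s' phi1 phi'
  else phi' = phi.

Definition small_subsets (Y : {fset var}) (k : nat) : {fset {fset var}} :=
  [fset S in fpowerset Y | (S != fset0) && (#|` S| <= k)].

Definition subset_pairs (Y : {fset var}) (k : nat) :
    seq ({fset var} * {fset var}) :=
  [seq P <- [seq (S1, S2) | S1 <- small_subsets Y k, S2 <- small_subsets Y k]
   | P.1 != P.2].

(* [ptable Y phi k psi]: psi is a possible result of the translation, the subsets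
   and the pairs of subsets being visited in an arbitrary order.  Visiting a pair
   in both orientations is harmless, since a row does not depend on it. *)
Definition ptable (Y : {fset var}) (phi : xorf) (k : nat) (psi : xorf) : Prop :=
  exists s1 s2 phi1 phi2,
    [/\ perm_eq s1 (small_subsets Y k) /\ perm_eq s2 (subset_pairs Y k),
        run (alias_step Y) s1 phi phi1,
        run table_step s2 phi1 phi2 &
        psi = phi2 `\` phi].

End PTable.

Definition primal_edge (phi : xorf) (x y : var) : Prop :=
  x <> y /\ exists2 C : xorc, C \in phi & (x \in C.1) && (y \in C.1).

(* As t is symmetric, [:: i; j] is a cycle for every edge, so acyclicity is about
   cycles with at least three nodes. *)
Definition is_tree (T : finType) (t : rel T) : Prop :=
  [/\ 0 < #|T|, symmetric t /\ irreflexive t,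
      forall i j, connect t i j
    & forall c : seq T, ucycle t c -> size c <= 2].

Definition tree_decomposition (V : {fset var}) (E : var -> var -> Prop)
    (n : nat) (t : rel 'I_n) (X : 'I_n -> {fset var}) : Prop :=
  [/\ is_tree t,
      V = \bigcup_(i in 'I_n) X i,
      forall x y, E x y -> exists i, (x \in X i) && (y \in X i)
    & forall v i j, v \in X i -> v \in X j ->
        connect [rel a b | [&& t a b, v \in X a & v \in X b]] i j].

(* Main.v *)
(* Aliases are global, so the values that unit propagation assigns to the
   aliases of the subsets of a bag form a set of linear equations over that bag,
   closed under addition thanks to the table rows, and two bags agree on the
   equations over their common variables.  When falsum is not derived, a solution
   of the equations of one bag can be extended one variable at a time, and from
   bag to bag along the tree, because a new bag meets the previous ones inside a
   single neighbour.  The resulting assignment satisfies the original formula, as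
   each of its constraints is a clique of the primal graph and lies in a bag. *)
Require Import Defs.
From Stdlib Require Import Classical.
From mathcomp Require Import all_boot.
From mathcomp Require Import finmap.

Set Implicit Arguments.
Unset Strict Implicit.
Unset Printing Implicit Defensive.

Local Open Scope fset_scope.

(** * Parities over finite sets and satisfaction of xor-constraints *)

Definition parity (tau : var -> bool) (S : {fset var}) : bool :=
  \big[addb/false]_(x <- S) tau x.

(** Padding with zeros to a common superset lets parities over different sets be added term by
    term. *)
Lemma parity_sub (tau : var -> bool) (S U : {fset var}) :
  S `<=` U -> parity tau S = \big[addb/false]_(x <- U) ((x \in S) && tau x).
Proof.
move=> sSU; rewrite -(big_fset_incl _ sSU); last by move=> x _ /negbTE ->.
by apply: eq_big_seq => x ->.
Qed.

Lemma in_symdiff (A B : {fset var}) (x : var) :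
  (x \in symdiff A B) = (x \in A) (+) (x \in B).
Proof. by rewrite !inE; case: (x \in A); case: (x \in B). Qed.

Lemma parity_symdiff (tau : var -> bool) (A B : {fset var}) :
  parity tau (symdiff A B) = parity tau A (+) parity tau B.
Proof.
have sAB : symdiff A B `<=` A `|` B.
  by apply/fsubsetP=> x; rewrite in_symdiff inE; case: (x \in A).
rewrite (parity_sub tau sAB) (parity_sub tau (fsubsetUl A B)).
rewrite (parity_sub tau (fsubsetUr A B)) -big_split /=.
by apply: eq_bigr => x _; rewrite in_symdiff andb_addl.
Qed.

Lemma parity1 (tau : var -> bool) (x : var) : parity tau [fset x] = tau x.
Proof. by rewrite /parity big_seq_fset1. Qed.

Lemma parity0 (tau : var -> bool) : parity tau fset0 = false.
Proof. by rewrite /parity big_seq_fset0. Qed.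

Lemma eq_parity (tau sigma : var -> bool) (S : {fset var}) :
  {in S, tau =1 sigma} -> parity tau S = parity sigma S.
Proof. by move=> E; apply: eq_big_seq => x /E. Qed.

Lemma symdiffxx (A : {fset var}) : symdiff A A = fset0.
Proof. by apply/fsetP=> x; rewrite in_symdiff addbb inE. Qed.

Lemma symdiff0s (A : {fset var}) : symdiff fset0 A = A.
Proof. by apply/fsetP=> x; rewrite in_symdiff inE. Qed.

Lemma symdiffs0 (A : {fset var}) : symdiff A fset0 = A.
Proof. by apply/fsetP=> x; rewrite in_symdiff inE addbF. Qed.

Lemma symdiff_neq0 (A B : {fset var}) : A != B -> symdiff A B != fset0.
Proof.
apply: contraNneq => E; apply/eqP/fsetP=> x; move/fsetP/(_ x): E.
by rewrite in_symdiff inE; case: (x \in A); case: (x \in B).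
Qed.

Lemma symdiff_sub (A B Y : {fset var}) :
  A `<=` Y -> B `<=` Y -> symdiff A B `<=` Y.
Proof.
move=> /fsubsetP sA /fsubsetP sB; apply/fsubsetP=> x; rewrite in_symdiff.
by case: (boolP (x \in A)) => [/sA|_ /=] // /sB.
Qed.

Lemma sub_vars (phi : xorf) (C : xorc) : C \in phi -> C.1 `<=` vars phi.
Proof.
by move=> Cphi; apply/fsubsetP=> x xC; apply/bigfcupP; exists C; rewrite ?Cphi.
Qed.

Lemma satc_eq (tau sigma : var -> bool) (C : xorc) :
  {in C.1, tau =1 sigma} -> satc tau C -> satc sigma C.
Proof. by move=> E; rewrite /satc => <-; symmetry; apply: eq_parity. Qed.

Lemma sat_eq (tau sigma : var -> bool) (phi : xorf) :
  {in vars phi, tau =1 sigma} -> sat tau phi -> sat sigma phi.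
Proof.
move=> E satphi C Cphi; apply: satc_eq (satphi C Cphi) => x xC.
by apply: E; apply: (fsubsetP (sub_vars Cphi)).
Qed.

Lemma satU (tau : var -> bool) (phi psi : xorf) :
  sat tau (phi `|` psi) <-> sat tau phi /\ sat tau psi.
Proof.
split=> [H|[H1 H2] C]; last by rewrite inE => /orP[/H1|/H2].
by split=> C CA; apply: H; rewrite inE CA ?orbT.
Qed.

Lemma satc_lit (tau : var -> bool) (x : var) (b : bool) :
  satc tau (lit x b) <-> tau x = b.
Proof. by rewrite /satc big_seq_fset1. Qed.

Lemma satc_alias_def (tau : var -> bool) (a : var) (S : {fset var}) :
  satc tau (alias_def a S) <-> tau a = parity tau S.
Proof.
rewrite /satc -/(parity tau _) parity_symdiff parity1 /=.
by case: (tau a); case: (parity _ _).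
Qed.

Lemma satc_table_row (tau : var -> bool) (a1 a2 a3 : var) :
  satc tau (table_row a1 a2 a3) <-> tau a3 = tau a1 (+) tau a2.
Proof.
rewrite /satc -/(parity tau _) !parity_symdiff !parity1 /=.
by case: (tau a1); case: (tau a2); case: (tau a3).
Qed.

Lemma mem_lits (ls : seq (var * bool)) (x : var) (b : bool) :
  (lit x b \in lits ls) = ((x, b) \in ls).
Proof.
apply/imfsetP/idP => [[[y c] /= yls [/fset1_inj -> ->]] //|xls].
by exists (x, b).
Qed.

Lemma sat_lits (tau : var -> bool) (ls : seq (var * bool)) :
  sat tau (lits ls) <-> {in ls, forall l, tau l.1 = l.2}.
Proof.
split=> [H l lls|H C /imfsetP[l /= lls ->]]; apply/satc_lit; last exact: H.
by apply: H; rewrite mem_lits -surjective_pairing.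
Qed.

(** * Extending a partial solution within one bag *)

Section LocalExtension.

Variables (L : {fset var} -> bool -> Prop) (X : {fset var}).
Hypothesis L_add : forall S1 S2 p1 p2, S1 `<=` X -> S2 `<=` X ->
  L S1 p1 -> L S2 p2 -> L (symdiff S1 S2) (p1 (+) p2).

(** If an equation of [L] over [Z] and [x] mentions [x], it fixes the value of [x]; any other such
    equation differs from it by an equation over [Z], which [tau] already satisfies. If there is
    none, [x] is free. *)
Lemma extend_var (tau : var -> bool) (x : var) (Z : {fset var}) :
  x |` Z `<=` X ->
  (forall S p, S `<=` Z -> L S p -> parity tau S = p) ->
  exists2 sigma : var -> bool, {in Z, sigma =1 tau} &
    forall S p, S `<=` x |` Z -> L S p -> parity sigma S = p.
Proof.
move=> sxZ solZ; case: (boolP (x \in Z)) => [xZ|xNZ].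
  by exists tau => // S p; rewrite mem_fset1U // => sS; apply: solZ.
pose upd b y := if y == x then b else tau y.
have updZ b : {in Z, upd b =1 tau}.
  by move=> y yZ; rewrite /upd; case: eqP => // E; rewrite -E yZ in xNZ.
have subZ S : S `<=` x |` Z -> x \notin S -> S `<=` Z.
  move=> /fsubsetP sS xNS; apply/fsubsetP=> y yS; move: (sS y yS).
  by rewrite !inE => /orP[/eqP E|//]; rewrite -E yS in xNS.
have parZ b S : S `<=` Z -> parity (upd b) S = parity tau S.
  by move=> sS; apply: eq_parity => y yS; apply/updZ/(fsubsetP sS).
case: (classic (exists S p, [/\ S `<=` x |` Z, L S p & x \in S])); last first.
  move=> none; exists (upd false) => [//|S p sS LS].
  case: (boolP (x \in S)) => [xS|xNS]; first by case: none; exists S, p.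
  by rewrite parZ ?(solZ S p) ?subZ.
move=> [S0 [p0 [sS0 LS0 xS0]]].
have [b solS0] : exists b, parity (upd b) S0 = p0.
  have E b : parity (upd b) S0 = b (+) parity tau (S0 `\ x).
    rewrite /parity (big_fsetD1 x) //= {1}/upd eqxx; congr (_ (+) _).
    by apply: eq_parity => y; rewrite !inE /upd => /andP[/negbTE ->].
  by exists (p0 (+) parity tau (S0 `\ x)); rewrite E addbK.
exists (upd b) => // S p sS LS.
case: (boolP (x \in S)) => [xS|xNS]; last by rewrite parZ ?(solZ S p) ?subZ.
have sD : symdiff S S0 `<=` Z.
  by apply: subZ; rewrite ?symdiff_sub // in_symdiff xS xS0.
have subX S' : S' `<=` x |` Z -> S' `<=` X by move/fsubset_trans; apply.
have := solZ _ _ sD (L_add (subX S sS) (subX S0 sS0) LS LS0).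
by rewrite -(parZ b) // parity_symdiff solS0 => /addIb.
Qed.

Lemma extend_bag (tau : var -> bool) (Z : {fset var}) :
  Z `<=` X -> (forall S p, S `<=` Z -> L S p -> parity tau S = p) ->
  exists2 sigma : var -> bool, {in Z, sigma =1 tau} &
    forall S p, S `<=` X -> L S p -> parity sigma S = p.
Proof.
move=> sZ solZ.
(* The variables of [X] are added on top of [Z] one by one, in the order of a list. *)
have ext (s : seq var) : {subset s <= X} -> exists2 sigma : var -> bool,
    {in Z, sigma =1 tau} &
    forall S p, S `<=` [fset y in s] `|` Z -> L S p -> parity sigma S = p.
  elim: s => [|x s IHs] sX.
    by exists tau => // S p; rewrite fset_nil fset0U; apply: solZ.
  have [|sigma sigmaZ sol] := IHs.
    by move=> y ys; rewrite sX ?inE ?ys ?orbT.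
  have [||rho rhoZ solx] := @extend_var sigma x ([fset y in s] `|` Z) => //.
    apply/fsubsetP => y; rewrite !inE orbA => /orP[ys|/(fsubsetP sZ) //].
    by apply: sX; rewrite inE.
  exists rho; first by move=> y yZ; rewrite rhoZ ?sigmaZ // !inE yZ orbT.
  by move=> S p sS; apply: solx; rewrite fsetUA -fset_cons.
have [|sigma sigmaZ sol] := ext X; first by [].
exists sigma => // S p sS; apply: sol; apply: fsubset_trans sS _.
by apply/fsubsetP=> y yX; rewrite !inE yX.
Qed.

End LocalExtension.

(** * Soundness and derived rules of unit propagation *)

Lemma up_mono (psi psi' : xorf) (C : xorc) :
  psi `<=` psi' -> up psi C -> up psi' C.
Proof.
move=> /fsubsetP sub; elim=> [D /sub|x b S p _ IH1 _ IH2 xS].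
  exact: up_premise.
exact: up_propagate.
Qed.

Lemma up_sound (tau : var -> bool) (psi : xorf) (C : xorc) :
  sat tau psi -> up psi C -> satc tau C.
Proof.
move=> satpsi; elim=> [D /satpsi //|x b S p _ /satc_lit Ex _ ES xS].
by move: ES; rewrite /satc /= (big_fsetD1 x) //= Ex addbC => <-; rewrite addbK.
Qed.

Lemma falsum_unsat (tau : var -> bool) : ~ satc tau falsum.
Proof. by rewrite /satc big_seq_fset0. Qed.

Section UnitPropagation.

Variable F : xorf.
Hypothesis F_consistent : ~ up F falsum.

Lemma up_lit_inj (x : var) (b c : bool) :
  up F (lit x b) -> up F (lit x c) -> b = c.
Proof.
move=> ub uc; apply: NNPP => bc; apply: F_consistent.
(* Propagating one literal into the other leaves the empty left-hand side with value [c (+) b],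
   which is [falsum] when the two differ. *)
have := up_propagate ub uc (fset11 x); rewrite fsetDv.
by case: b c bc {ub uc} => [] [].
Qed.

Lemma up_eliminate (x : var) (b : bool) (S : {fset var}) (p : bool) :
  up F (lit x b) -> up F (S, p) -> up F (S `\ x, p (+) ((x \in S) && b)).
Proof.
move=> ux uS; case: (boolP (x \in S)) => [xS|xNS]; first exact: up_propagate.
by rewrite addbF mem_fsetD1.
Qed.

(** Aliases need not be distinct, and a row is stored with duplicates cancelled. When two of the
    three coincide, the row is itself a literal and uniqueness of derived values gives the claim;
    otherwise two propagations isolate [a3]. *)
Lemma up_table_row (a1 a2 a3 : var) (p1 p2 : bool) :
  table_row a1 a2 a3 \in F ->
  up F (lit a1 p1) -> up F (lit a2 p2) -> up F (lit a3 (p1 (+) p2)).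
Proof.
move=> /up_premise row u1 u2.
have litE (A : {fset var}) a b : A =i [fset a] -> (A, b) = lit a b.
  by move=> /fsetP ->.
case: (eqVneq a1 a2) => [E12|N12].
  rewrite -E12 in u2 row *; rewrite (up_lit_inj u1 u2) addbb.
  suff <- : table_row a1 a1 a3 = lit a3 false by [].
  by apply: litE => x; rewrite !in_symdiff addbA addbb.
case: (eqVneq a1 a3) => [E13|N13].
  have Erow : table_row a1 a2 a3 = lit a2 false.
    apply: litE => x.
    by rewrite -E13 !in_symdiff addbC -addbA addbb addbF.
  by rewrite Erow in row; rewrite (up_lit_inj u2 row) -E13 addbF.
case: (eqVneq a2 a3) => [E23|N23].
  have Erow : table_row a1 a2 a3 = lit a1 false.
    by apply: litE => x; rewrite -E23 !in_symdiff addbb addbF.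
  by rewrite Erow in row; rewrite (up_lit_inj u1 row) -E23.
have := up_eliminate u2 (up_eliminate u1 row).
rewrite (litE _ a3); last first.
  move=> x; rewrite !in_fsetD1 !in_symdiff !in_fset1.
  case: (eqVneq x a1) => [->|_]; first by rewrite andbF (negbTE N13).
  by case: (eqVneq x a2) => [->|_]; rewrite ?(negbTE N23).
rewrite in_fsetD1 !in_symdiff !in_fset1 !eqxx [a2 == a1]eq_sym.
by rewrite (negbTE N12) (negbTE N13) (negbTE N23).
Qed.

(** If the variable is its own alias there is nothing to show. Otherwise the definition is a
    two-variable equation, through which values propagate both ways. *)
Lemma up_alias1 (a x : var) (p : bool) :
  alias_def a [fset x] \in F -> up F (lit a p) <-> up F (lit x p).
Proof.
move=> /up_premise; rewrite /alias_def.
case: (eqVneq a x) => [-> //|ax] def.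
have Ea : symdiff [fset a] [fset x] `\ a = [fset x].
  apply/fsetP=> z; rewrite in_fsetD1 in_symdiff !in_fset1.
  by case: (eqVneq z a) => [->|]; rewrite ?(negbTE ax).
have Ex : symdiff [fset a] [fset x] `\ x = [fset a].
  apply/fsetP=> z; rewrite in_fsetD1 in_symdiff !in_fset1 addbC.
  by case: (eqVneq z x) => [->|]; rewrite // [x == a]eq_sym (negbTE ax).
split=> /up_eliminate /(_ def).
  by rewrite Ea in_symdiff !inE eqxx (negbTE ax).
by rewrite Ex in_symdiff !inE eqxx eq_sym (negbTE ax).
Qed.

End UnitPropagation.

(** * Trees and tree decompositions *)

Lemma tree_edge_bridge (T : finType) (t : rel T) (i j : T) :
  is_tree t -> t i j ->
  ~~ connect [rel a b | t a b && ((a, b) \notin [:: (i, j); (j, i)])] j i.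
Proof.
move=> [_ [tC tI] _ acyclic] tij; apply/negP=> /connectP[q].
case/shortenP=> {}q pathq uniqq _ lastq.
have pathtq : path t j q by apply: sub_path pathq => a b /andP[].
(* A simple path from [j] to [i]: length zero would make the edge a loop, length one would be the
   removed edge, and anything longer closes up with the edge to a cycle of at least three nodes. *)
case: q => [|x [|y q]] in pathq uniqq lastq pathtq.
- by move: tij; rewrite lastq tI.
- by move: pathq; rewrite /= -[x]lastq !inE eqxx orbT andbF.
have := acyclic (j :: x :: y :: q).
rewrite /ucycle uniqq andbT /cycle rcons_path pathtq -lastq.
by move/(_ tij).
Qed.

Section TreeDecomposition.

Variables (V : {fset var}) (E : var -> var -> Prop).
Variables (n : nat) (t : rel 'I_n) (X : 'I_n -> {fset var}).
Hypothesis tdX : tree_decomposition V E t X.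

(** Bags are collected from [r] along tree edges. A variable shared by the new bag [j] and an old
    bag but missing from the neighbour [i] would yield a way from [j] to [i] that bypasses the edge
    between them. *)
Lemma bag_ind (r : 'I_n) (P : {set 'I_n} -> Prop) :
  P [set r] ->
  (forall (A : {set 'I_n}) (i j : 'I_n), r \in A -> i \in A ->
     (forall v m, m \in A -> v \in X j -> v \in X m -> v \in X i) ->
     P A -> P (j |: A)) ->
  P [set: 'I_n].
Proof.
case: tdX => treet _ _ vconn Pr Pstep.
have [_ [tC tI] tconn _] := treet.
pose tin (A : {set 'I_n}) := [rel a b | [&& t a b, a \in A & b \in A]].
(* Connectedness of [A] within itself is carried along: it supplies paths from old nodes to [i] that
   avoid [j]. *)
suff grow d (A : {set 'I_n}) : #|~: A| = d -> r \in A ->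
    {in A &, forall a b, connect (tin A) a b} -> P A -> P [set: 'I_n].
  apply: (grow _ _ erefl) Pr; first by rewrite inE.
  by move=> a b /set1P-> /set1P->.
elim: d A => [|d IHd] A dA rA Aconn PA.
  suff -> : [set: 'I_n] = A by [].
  apply/setP=> x; move/eqP: dA; rewrite cards_eq0 => /eqP/setP/(_ x).
  by rewrite !inE => /negbFE.
(* As the tree is connected, some edge leaves [A] while its complement is nonempty. *)
have [i [j [iA jNA tij]]] : exists i j, [/\ i \in A, j \notin A & t i j].
  apply: NNPP => noedge.
  have [y] : exists y, y \in ~: A by apply/card_gt0P; rewrite dA.
  rewrite inE => /negP; apply.
  have /connectP[q pathq ->] := tconn r y.
  elim: q r rA pathq {Pr Pstep IHd} => [//|z q IHq] x xA /= /andP[txz].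
  apply: IHq; apply: contra_notT noedge => zNA.
  by exists x, z.
have rip v m : m \in A -> v \in X j -> v \in X m -> v \in X i.
  move=> mA vj vm; apply: contraT => vNi.
  case/negP: (tree_edge_bridge treet tij).
  (* The path from j to m runs through nodes containing v, hence avoids i,
     and the one from m to i inside A avoids j. *)
  apply: (@connect_trans _ _ m).
    apply: connect_sub (vconn v j m vj vm) => a b /= /and3P[tab va vb].
    apply: connect1; rewrite /= tab !inE !xpair_eqE.
    have /negbTE -> : a != i by apply: contraNneq vNi => <-.
    have /negbTE -> : b != i by apply: contraNneq vNi => <-.
    by rewrite andbF.
  apply: connect_sub (Aconn m i mA iA) => a b /= /and3P[tab aA bA].
  apply: connect1; rewrite /= tab !inE !xpair_eqE.
  have /negbTE -> : b != j by apply: contraNneq jNA => <-.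
  have /negbTE -> : a != j by apply: contraNneq jNA => <-.
  by rewrite andbF.
have sub_tin : subrel (connect (tin A)) (connect (tin (j |: A))).
  apply: connect_sub => a b /= /and3P[tab aA bA].
  by apply: connect1; rewrite /= tab !inE aA bA !orbT.
have tinij : connect (tin (j |: A)) i j.
  by apply: connect1; rewrite /= tij !inE iA eqxx orbT.
have tinji : connect (tin (j |: A)) j i.
  by apply: connect1; rewrite /= tC tij !inE iA eqxx orbT.
apply: (IHd (j |: A)).
- have := cardsC (j |: A); rewrite cardsU1 jNA -(cardsC A) dA add1n addSn addnS.
  by move=> [/addnI].
- by rewrite !inE rA orbT.
- move=> a b; rewrite !in_setU1 => /orP[/eqP->|aA] /orP[/eqP->|bA].
  + exact: connect0.
  + by apply: (connect_trans tinji); apply/sub_tin/Aconn.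
  + by apply: (connect_trans _ tinij); apply/sub_tin/Aconn.
  + exact/sub_tin/Aconn.
- exact: (Pstep A i).
Qed.

(** This is the Helly property of subtrees. The induction assumes that any two elements of [Q] share
    a bag among those collected so far. *)
Lemma clique_in_bag (S : {fset var}) :
  {subset S <= V} -> {in S &, forall x y, x <> y -> E x y} ->
  exists i, S `<=` X i.
Proof.
case: (tdX) => treet defV edges _ sSV cliqueS.
have [r _] : exists r : 'I_n, r \in 'I_n.
  by case: treet => /card_gt0P.
pose P (A : {set 'I_n}) := forall Q : {fset var},
  {in Q &, forall x y, exists2 m, m \in A & (x \in X m) && (y \in X m)} ->
  exists i, Q `<=` X i.
suff: P [set: 'I_n].
  apply=> x y xS yS; case: (eqVneq x y) => [<-|/eqP xy].
    have := sSV x xS; rewrite defV => /bigfcupP[i _ xi].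
    by exists i; rewrite ?inE ?xi.
  by have [i xyi] := edges x y (cliqueS x y xS yS xy); exists i; rewrite ?inE.
apply: (bag_ind (r := r)) => [Q QP|A i j rA iA rip IH Q QP].
  exists r; apply/fsubsetP=> x xQ.
  by have [m /set1P -> /andP[]] := QP x x xQ xQ.
(* Either some element of [Q] occurs in no old bag, and then all its pairs, hence all of [Q], lie in
   bag [j]; or every element occurs in an old bag, and then a pair in bag [j] also lies in bag [i],
   so the old bags suffice. *)
case: (classic (exists2 x, x \in Q & forall m, m \in A -> x \notin X m)).
  move=> [x xQ xNA]; exists j; apply/fsubsetP=> y yQ.
  have [m] := QP x y xQ yQ; rewrite in_setU1 => /orP[/eqP-> /andP[] //|mA].
  by rewrite (negbTE (xNA m mA)).
move=> oldQ; apply: IH => x y xQ yQ.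
have [m] := QP x y xQ yQ; rewrite in_setU1.
case/orP=> [/eqP->|mA xym]; last by exists m.
have old z : z \in Q -> z \in X j -> z \in X i.
  move=> zQ zj; apply: contra_notT oldQ => zNi; exists z => // l lA.
  by apply: contra zNi; apply: rip zj.
by case/andP=> xj yj; exists i => //; rewrite !old.
Qed.

Lemma extend_tree (L : {fset var} -> bool -> Prop) (r : 'I_n)
    (tau : var -> bool) (Z : {fset var}) :
  (forall i S1 S2 p1 p2, S1 `<=` X i -> S2 `<=` X i ->
     L S1 p1 -> L S2 p2 -> L (symdiff S1 S2) (p1 (+) p2)) ->
  Z `<=` X r -> (forall S p, S `<=` Z -> L S p -> parity tau S = p) ->
  exists2 sigma : var -> bool, {in Z, sigma =1 tau} &
    forall i S p, S `<=` X i -> L S p -> parity sigma S = p.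
Proof.
move=> L_add sZ solZ.
suff [sigma sigmaZ sol] : exists2 sigma : var -> bool, {in Z, sigma =1 tau} &
    forall i S p, i \in [set: 'I_n] -> S `<=` X i -> L S p ->
      parity sigma S = p.
  by exists sigma => // i S p; apply: sol; rewrite inE.
apply: (bag_ind (r := r) (P := fun A : {set 'I_n} =>
  exists2 sigma : var -> bool, {in Z, sigma =1 tau} &
    forall i S p, i \in A -> S `<=` X i -> L S p -> parity sigma S = p)).
  have [sigma sigmaZ sol] := extend_bag (L_add r) sZ solZ.
  by exists sigma => // i S p /set1P ->; apply: sol.
move=> A i j rA iA rip [sigma sigmaZ sol].
(* Only the values shared with the neighbour [i] are prescribed; by [rip] they cover every variable
   of [X j] that occurs in an earlier bag. *)
have [||rho rhoW solj] := @extend_bag L (X j) (L_add j) sigma (X j `&` X i).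
- exact: fsubsetIl.
- by move=> S p; rewrite fsubsetI => /andP[_]; apply: sol.
pose glue v := if v \in X j then rho v else sigma v.
have glueA m : m \in A -> {in X m, glue =1 sigma}.
  move=> mA v vm; rewrite /glue; case: ifP => // vj.
  by rewrite rhoW // inE vj (rip v m).
exists glue; first by move=> v vZ; rewrite (glueA r) ?sigmaZ ?(fsubsetP sZ).
move=> m S p; rewrite in_setU1 => /orP[/eqP->|mA] sS LS.
  rewrite -(solj S p) //; apply: eq_parity => v vS.
  by rewrite /glue (fsubsetP sS).
rewrite -(sol m S p) //; apply: eq_parity => v vS.
by rewrite (glueA m) // (fsubsetP sS).
Qed.

End TreeDecomposition.

(** * Model-preserving extensions and runs of the translation *)

(** The nontrivial half of [GE_models], in a form that composes along the steps of the
    translation. *)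
Definition conservative (phi phi' : xorf) : Prop :=
  phi `<=` phi' /\
  forall tau, sat tau phi ->
    exists2 sigma, sat sigma phi' & {in vars phi, sigma =1 tau}.

Lemma vars_sub (phi phi' : xorf) : phi `<=` phi' -> vars phi `<=` vars phi'.
Proof.
move=> /fsubsetP sub; apply/fsubsetP=> x /bigfcupP[C /andP[Cphi _] xC].
by apply/bigfcupP; exists C; rewrite ?sub.
Qed.

Lemma conservative_refl (phi : xorf) : conservative phi phi.
Proof. by split=> // tau; exists tau. Qed.

Lemma conservative_trans (phi2 phi1 phi3 : xorf) :
  conservative phi1 phi2 -> conservative phi2 phi3 -> conservative phi1 phi3.
Proof.
move=> [s12 c12] [s23 c23]; split=> [|tau /c12[sigma /c23[rho satrho E23] E12]].
  exact: fsubset_trans s23.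
exists rho => // x x1; rewrite E23 ?E12 //.
exact: (fsubsetP (vars_sub s12)).
Qed.

Lemma implied_conservative (phi phi' : xorf) :
  phi `<=` phi' -> (forall tau, sat tau phi -> sat tau phi') ->
  conservative phi phi'.
Proof. by move=> sub impl; split=> // tau /impl; exists tau. Qed.

Section Runs.

Variables (A : eqType) (step : A -> xorf -> xorf -> Prop).

Lemma run_conservative (s : seq A) (phi phi' : xorf) :
  (forall x psi psi', x \in s -> step x psi psi' -> conservative psi psi') ->
  run step s phi phi' -> conservative phi phi'.
Proof.
elim: s phi => [|x s IHs] phi stepc.
  by move=> ->; apply: conservative_refl.
case=> phi1 step1 run1; apply: (@conservative_trans phi1).
  by apply: stepc step1; apply: mem_head.
by apply: IHs run1 => y psi psi' ys; apply: stepc; rewrite inE ys orbT.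
Qed.

(** Formulas only grow, so what a step finds and adds when [x] is visited can be related to the
    initial and final formulas. *)
Lemma run_visit (s : seq A) (phi phi' : xorf) (x : A) :
  (forall y psi psi', step y psi psi' -> psi `<=` psi') ->
  run step s phi phi' -> x \in s ->
  exists psi psi', [/\ phi `<=` psi, step x psi psi' & psi' `<=` phi'].
Proof.
move=> mono; have run_mono r psi psi' : run step r psi psi' -> psi `<=` psi'.
  elim: r psi => [|y r IHr] psi; first by move=> ->.
  by case=> psi1 /mono s1 /IHr; apply: fsubset_trans.
elim: s phi => [//|y s IHs] phi [phi1 step1 run1]; rewrite inE.
case/orP=> [/eqP->|/(IHs _ run1)[psi [psi' [s1 s2 s3]]]].
  by exists phi, phi1; split; rewrite // (run_mono s).
by exists psi, psi'; split=> //; apply: fsubset_trans s1; apply: mono step1.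
Qed.

Lemma card_run (c : nat) (s : seq A) (phi phi' : xorf) :
  (forall x psi psi', step x psi psi' -> #|` psi'| <= #|` psi| + c) ->
  run step s phi phi' -> #|` phi'| <= #|` phi| + c * size s.
Proof.
move=> stepc; elim: s phi => [|x s IHs] phi.
  by move=> ->; rewrite muln0 addn0.
case=> phi1 /stepc le1 /IHs le2; apply: leq_trans le2 _.
by rewrite /= mulnS addnA leq_add2r.
Qed.

End Runs.

(** * The translation of one bag: models, tables and size *)

Section Translation.

Variable al : {fset var} -> var.

Definition alias_lits (phi : xorf) (S : {fset var}) : xorf :=
  [fset lit (al S) p | p in [:: false; true] & (S, p) \in phi].

Lemma find_alias_sub (Y S : {fset var}) (phi phi' : xorf) :
  find_alias al Y phi S phi' -> phi `<=` phi'.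
Proof. by case=> // _ _; apply: fsubsetUr. Qed.

Lemma alias_step_sub (Y S : {fset var}) (phi phi' : xorf) :
  alias_step al Y S phi phi' -> phi `<=` phi'.
Proof.
move=> [phi1 /find_alias_sub sub ->]; apply: fsubset_trans sub _.
exact: fsubsetUl.
Qed.

Lemma table_step_sub P (phi phi' : xorf) :
  table_step al P phi phi' -> phi `<=` phi'.
Proof. by case=> // _ _ _; apply: fsubsetUr. Qed.

Lemma alias_step_def (Y S : {fset var}) (phi phi' : xorf) :
  alias_step al Y S phi phi' ->
  alias_def (al S) S \in phi' /\
  forall p, (S, p) \in phi -> lit (al S) p \in phi'.
Proof.
move=> [phi1 fa ->]; split.
  by case: fa => [def|_ _]; rewrite !inE ?def ?eqxx.
move=> p Sp; rewrite inE; apply/orP; right; apply/imfsetP; exists p => //=.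
by rewrite !inE (fsubsetP (find_alias_sub fa)) //; case: (p).
Qed.

(** A new alias is given the parity of [S] as its value. It lies outside [vars phi], so old
    constraints keep their truth value, and outside [Y], so that parity does not depend on it. The
    added literals then follow from the alias definition. *)
Lemma alias_step_conservative (Y S : {fset var}) (phi phi' : xorf) :
  S `<=` Y -> alias_step al Y S phi phi' -> conservative phi phi'.
Proof.
move=> sSY [phi1 fa ->]; apply: (@conservative_trans phi1).
  case: fa => [_|_ fresh]; first exact: conservative_refl.
  split=> [|tau sattau]; first exact: fsubsetUr.
  pose sigma x := if x == al S then parity tau S else tau x.
  have sigmaE (A : {fset var}) : al S \notin A -> {in A, tau =1 sigma}.
    by move=> aA x xA; rewrite /sigma; case: eqP => // E; rewrite -E xA in aA.
  move: fresh; rewrite inE negb_or => /andP[avars aY].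
  exists sigma; last by move=> x /(sigmaE _ avars).
  move=> C; rewrite inE => /orP[/fset1P->|]; last first.
    exact: (sat_eq (sigmaE _ avars)).
  apply/satc_alias_def; rewrite {1}/sigma eqxx; apply: eq_parity.
  by apply: sigmaE; apply: contra aY; apply: (fsubsetP sSY).
have def : alias_def (al S) S \in phi1.
  by case: fa => [//|_ _]; rewrite !inE eqxx.
apply: implied_conservative => [|tau sattau]; first exact: fsubsetUl.
apply/satU; split=> // C /imfsetP[p /= /andP[_ Sp] ->].
by apply/satc_lit; apply: etrans (sattau _ Sp); apply/satc_alias_def/sattau.
Qed.

Lemma table_step_conservative P (phi phi' : xorf) :
  table_step al P phi phi' -> conservative phi phi'.
Proof.
case=> [d1 d2 d3|_]; last exact: conservative_refl.
apply: implied_conservative => [|tau sattau]; first exact: fsubsetUr.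
move=> C; rewrite inE => /orP[/fset1P->|/sattau //].
have val S : alias_def (al S) S \in phi -> tau (al S) = parity tau S.
  by move=> /sattau/satc_alias_def.
by apply/satc_table_row; rewrite !val // parity_symdiff.
Qed.

Lemma mem_small_subsets (Y S : {fset var}) :
  (S \in small_subsets Y #|` Y|) = (S `<=` Y) && (S != fset0).
Proof.
rewrite !inE /= fpowersetE; case: (boolP (S `<=` Y)) => //= sSY.
by rewrite fsubset_leq_card // andbT.
Qed.

(** Keeping the input and output formulas apart lets a table built from an intermediate formula
    serve for the original one. *)
Record tabulated (Y : {fset var}) (phi phi' : xorf) : Prop := {
  tab_alias : forall S, S `<=` Y -> S != fset0 -> alias_def (al S) S \in phi';
  tab_lit : forall S p, S `<=` Y -> S != fset0 -> (S, p) \in phi ->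
    lit (al S) p \in phi';
  tab_row : forall S1 S2, S1 `<=` Y -> S2 `<=` Y ->
    S1 != fset0 -> S2 != fset0 -> S1 != S2 ->
    table_row (al S1) (al S2) (al (symdiff S1 S2)) \in phi' }.

(** For the size, each subset costs at most three constraints (an alias definition and two literals)
    and each pair at most one row. With $N=2^{|Y|}$ this gives $3N+N^2\le 4N^2$. *)
Lemma ptable_spec (Y : {fset var}) (phi psi : xorf) :
  ptable al Y phi #|` Y| psi ->
  [/\ conservative phi (phi `|` psi), tabulated Y phi (phi `|` psi) &
      #|` phi `|` psi| <= #|` phi| + 4 * 2 ^ (2 * #|` Y|)].
Proof.
move=> [s1 [s2 [phi1 [phi2 [[perm1 perm2] run1 run2 ->]]]]].
have mem1 S : (S \in s1) = (S `<=` Y) && (S != fset0).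
  by rewrite (perm_mem perm1) -mem_small_subsets.
have c1 : conservative phi phi1.
  apply: run_conservative run1 => S psi1 psi2; rewrite mem1 => /andP[sS _].
  exact: alias_step_conservative.
have c2 : conservative phi1 phi2.
  apply: run_conservative run2 => P psi1 psi2 _; exact: table_step_conservative.
have c12 := conservative_trans c1 c2.
have -> : phi `|` (phi2 `\` phi) = phi2.
  apply/fsetP=> C; rewrite !inE; case: (boolP (C \in phi)) => //=.
  by move/(fsubsetP (proj1 c12)) ->.
have al1 S : S `<=` Y -> S != fset0 -> alias_def (al S) S \in phi1 /\
    forall p, (S, p) \in phi -> lit (al S) p \in phi1.
  move=> sS S0; have inS : S \in s1 by rewrite mem1 sS.
  have [psi1 [psi2 [sub1 /alias_step_def[def lt] sub2]]] :=
    run_visit (@alias_step_sub Y) run1 inS.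
  split=> [|p Sp]; first exact: (fsubsetP sub2).
  exact/(fsubsetP sub2)/lt/(fsubsetP sub1).
split=> //.
  split=> [S sS S0|S p sS S0 Sp|S1 S2 s1Y s2Y S10 S20 S12].
  - exact: (fsubsetP (proj1 c2) _ (proj1 (al1 S sS S0))).
  - exact: (fsubsetP (proj1 c2) _ (proj2 (al1 S sS S0) p Sp)).
  have inP : (S1, S2) \in s2.
    rewrite (perm_mem perm2) mem_filter S12; apply/allpairsP; exists (S1, S2).
    by rewrite !mem_small_subsets s1Y s2Y S10 S20.
  have [psi1 [psi2 [sub1 st sub2]]] := run_visit table_step_sub run2 inP.
  apply: (fsubsetP sub2); case: st => [_ _ _|]; first by rewrite !inE eqxx.
  (* A skip is impossible: the symmetric difference of distinct subsets of [Y] is a nonempty subset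
     of [Y], whose alias was defined in the first phase. *)
  case; exists (al (symdiff S1 S2)); apply: (fsubsetP sub1).
  by apply: (proj1 (al1 _ _ _)); rewrite ?symdiff_sub ?symdiff_neq0.
have size1 : size s1 <= 2 ^ #|` Y|.
  rewrite (perm_size perm1) -card_fpowerset; apply: fsubset_leq_card.
  by apply/fsubsetP=> S; rewrite mem_small_subsets fpowersetE => /andP[].
have size2 : size s2 <= 2 ^ #|` Y| * 2 ^ #|` Y|.
  rewrite (perm_size perm2) size_filter (leq_trans (count_size _ _)) //.
  by rewrite size_allpairs -!(perm_size perm1) leq_mul.
have cfU1 (C : xorc) (D : xorf) : #|` C |` D| <= 1 + #|` D|.
  by rewrite cardfsU1 leq_add2r leq_b1.
have le1 : #|` phi1| <= #|` phi| + 3 * size s1.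
  apply: card_run run1 => S psi1 psi2 [psi3 fa ->].
  rewrite (leq_trans (leq_card_fsetU _ _)) //.
  rewrite addnC (addnC _ 3) -[3]/(2 + 1)%N -addnA leq_add //; last first.
    by case: fa => [_|_ _]; rewrite ?cfU1 ?leqnSn.
  suff sub2 : alias_lits psi3 S `<=` [fset lit (al S) false; lit (al S) true].
    apply: leq_trans (fsubset_leq_card sub2) _.
    by rewrite cardfs2; case: (_ != _).
  apply/fsubsetP=> C /imfsetP[p _ ->].
  by rewrite !inE; case: p; rewrite eqxx ?orbT.
have le2 : #|` phi2| <= #|` phi1| + 1 * size s2.
  apply: card_run run2 => P psi1 _ [_ _ _|_]; last exact: leq_addr.
  by rewrite addnC.
rewrite mul2n -addnn expnD.
have pos : 0 < 2 ^ #|` Y| by rewrite expn_gt0.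
move: (2 ^ #|` Y|) pos size1 size2 => N pos size1 size2.
apply: leq_trans le2 _; rewrite mul1n.
apply: leq_trans (leq_add le1 size2) _; rewrite -addnA leq_add2l.
rewrite (mulSn 3) addnC leq_add2l leq_mul2l /=.
by apply: leq_trans size1 _; rewrite leq_pmulr.
Qed.

End Translation.

Lemma tabulated_sub (al : {fset var} -> var) (Y : {fset var})
    (phi psi phi' psi' : xorf) :
  phi' `<=` phi -> psi `<=` psi' ->
  tabulated al Y phi psi -> tabulated al Y phi' psi'.
Proof.
move=> /fsubsetP sphi /fsubsetP spsi [def lt row].
split=> *; apply: spsi; first exact: def; last exact: row.
by apply: lt => //; apply: sphi.
Qed.

(** * From the absence of a conflict to a model *)

Section Completeness.

Variables (phixor : xorf) (n : nat) (t : rel 'I_n) (X : 'I_n -> {fset var}).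
Variables (al : {fset var} -> var) (F : xorf).
Hypothesis tdX : tree_decomposition (vars phixor) (primal_edge phixor) t X.
Hypothesis F_consistent : ~ up F falsum.
Hypothesis F_phi : phixor `<=` F.
Hypothesis F_tab : forall i, tabulated al (X i) phixor F.

(* The empty set has no alias. *)
Definition known (S : {fset var}) (p : bool) : Prop :=
  if S == fset0 then p = false else up F (lit (al S) p).

Lemma known_add (i : 'I_n) (S1 S2 : {fset var}) (p1 p2 : bool) :
  S1 `<=` X i -> S2 `<=` X i ->
  known S1 p1 -> known S2 p2 -> known (symdiff S1 S2) (p1 (+) p2).
Proof.
move=> s1 s2; rewrite {1 2}/known.
case: (eqVneq S1 fset0) => [-> ->|S10 u1];
  case: (eqVneq S2 fset0) => [->|S20 u2].
- by move=> ->; rewrite symdiffxx /known eqxx.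
- by rewrite symdiff0s /known (negbTE S20).
- by move=> ->; rewrite symdiffs0 addbF /known (negbTE S10).
case: (eqVneq S1 S2) => [E|S12].
  rewrite -E symdiffxx in u2 *.
  by rewrite /known eqxx (up_lit_inj _ u1 u2) ?addbb.
rewrite /known (negbTE (symdiff_neq0 S12)).
exact: (up_table_row F_consistent (tab_row (F_tab i) s1 s2 S10 S20 S12)).
Qed.

Lemma known1 (x : var) (p : bool) :
  x \in vars phixor -> known [fset x] p <-> up F (lit x p).
Proof.
case: tdX => _ -> _ _ /bigfcupP[i _ xi].
have x0 : [fset x] != fset0 by apply/fset0Pn; exists x; rewrite inE.
rewrite /known (negbTE x0); apply: up_alias1.
by apply: (tab_alias (F_tab i)); rewrite ?fsub1set.
Qed.

(** The variables of a constraint form a clique of the primal graph, so some bag contains them and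
    its table holds the alias literal. An empty constraint of [phixor] has right-hand side bottom,
    as otherwise it would be [falsum]. *)
Lemma known_constraint (S : {fset var}) (p : bool) :
  (S, p) \in phixor -> (exists i, S `<=` X i) /\ known S p.
Proof.
move=> Sp; have [i sSi] : exists i, S `<=` X i.
  apply: (clique_in_bag tdX); first exact/fsubsetP/(sub_vars Sp).
  by move=> x y xS yS xy; split=> //; exists (S, p); rewrite //= xS.
split; first by exists i.
rewrite /known; case: (eqVneq S fset0) => [S0|S0]; last first.
  exact/up_premise/(tab_lit (F_tab i)).
have /up_premise := fsubsetP F_phi _ Sp; rewrite S0.
by case: p {Sp}.
Qed.

(** The freedom in [tau] and [Z] serves two uses: an empty [Z] yields satisfiability, and a
    singleton [Z] yields a model falsifying a literal that was not derived. *)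
Lemma known_model (ls : seq (var * bool)) (r : 'I_n) (tau : var -> bool)
    (Z : {fset var}) :
  lits ls `<=` F -> Z `<=` X r ->
  (forall S p, S `<=` Z -> known S p -> parity tau S = p) ->
  exists2 sigma, sat sigma (phixor `|` lits ls) & {in Z, sigma =1 tau}.
Proof.
move=> F_ls sZ solZ.
have [sigma sigmaZ sol] := extend_tree tdX known_add sZ solZ.
have F_lit x p : (x, p) \in ls -> up F (lit x p).
  by move=> xp; apply/up_premise/(fsubsetP F_ls); rewrite mem_lits.
(* Outside [phixor] no equation applies, so the assumptions dictate the value; they cannot clash,
   since [F] derives no conflict. *)
pose rho x := if x \in vars phixor then sigma x else (x, true) \in ls.
have rhoE : {in vars phixor, rho =1 sigma} by move=> x; rewrite /rho => ->.
case: (tdX) => _ defV _ _.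
exists rho; last first.
  move=> x xZ; rewrite rhoE ?sigmaZ // defV.
  by apply/bigfcupP; exists r; rewrite ?mem_index_enum ?(fsubsetP sZ).
apply/satU; split.
  apply: (sat_eq (tau := sigma)) => [x xphi|[S p] Sp]; first by rewrite rhoE.
  by have [[i sSi] /(sol i _ _ sSi)] := known_constraint Sp.
apply/sat_lits=> -[x p] /= xp; rewrite /rho; case: ifP => xphi.
  have [i _ xi] : exists2 i, true & x \in X i.
    by move: xphi; rewrite defV => /bigfcupP[i _ xi]; exists i.
  rewrite -(parity1 sigma) (sol i _ p) ?fsub1set //.
  exact/known1/F_lit.
case: p xp => // xp; apply/negP=> /F_lit xt.
by have := up_lit_inj F_consistent xt (F_lit _ _ xp).
Qed.

End Completeness.

(** * The chain over all bags and the theorem *)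

Lemma chain_spec (n : nat) (X : 'I_n -> {fset var}) (al : {fset var} -> var)
    (phi : nat -> xorf) :
  (forall i : 'I_n, exists2 psi : xorf,
     ptable al (X i) (phi i) #|` X i| psi & phi i.+1 = phi i `|` psi) ->
  [/\ conservative (phi 0) (phi n),
      forall i, tabulated al (X i) (phi 0) (phi n) &
      #|` phi n| <= #|` phi 0| + n * (4 * 2 ^ (2 * \max_(i < n) #|` X i|))].
Proof.
move=> steps; set K := \max_(i < n) _.
have step (i : 'I_n) : [/\ conservative (phi i) (phi i.+1),
    tabulated al (X i) (phi i) (phi i.+1) &
    #|` phi i.+1| <= #|` phi i| + 4 * 2 ^ (2 * K)].
  have [psi pt ->] := steps i; have [c tab le] := ptable_spec pt; split=> //.
  apply: leq_trans le _; rewrite leq_add2l leq_mul2l leq_exp2l // leq_mul2l.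
  exact: (leq_bigmax i).
move: (4 * 2 ^ (2 * K)) step => N step.
(* An arbitrary starting point is needed: the table of bag [i] is compared with [phi 0] before its
   creation and with [phi n] after it. *)
have cons m d : m + d <= n -> conservative (phi m) (phi (m + d)%N).
  elim: d => [|d IHd]; rewrite ?addn0 ?addnS.
    by move=> _; apply: conservative_refl.
  move=> lt; apply: conservative_trans (IHd (ltnW lt)) _.
  by have [] := step (Ordinal lt).
split=> [|i|]; first exact: (cons 0).
  have [_ tab _] := step i; apply: tabulated_sub tab.
    by have [] := cons 0 i (ltnW (ltn_ord i)).
  by have [] := cons i.+1 (n - i.+1); rewrite subnKC.
have le m : m <= n -> #|` phi m| <= #|` phi 0| + m * N.
  elim: m => [|m IHm] lt; first by rewrite mul0n addn0.
  have [_ _ /= /leq_trans] := step (Ordinal lt); apply.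
  by rewrite mulSnr addnA leq_add2r IHm // ltnW.
exact: le.
Qed.

(** Giving the variable of [l] the opposite value in a model affects no constraint of [phi], so an
    assumption must forbid this, and only [l] itself can. *)
Lemma entails_foreign (phi : xorf) (ls : seq (var * bool)) (l : var * bool) :
  l.1 \notin vars phi -> satisfiable (phi `|` lits ls) ->
  entails (phi `|` lits ls) (lit l.1 l.2) -> l \in ls.
Proof.
case: l => x b /= xphi [tau /satU[sattau /sat_lits lstau]] ent.
apply: contraT => lNls; pose sigma y := if y == x then ~~ b else tau y.
have: satc sigma (lit x b).
  have xlits c : (x, c) \in ls -> c = ~~ b.
    by case: c b lNls {ent sigma} => [] [] // /negP.
  apply: ent; apply/satU; split.
    apply: (sat_eq (tau := tau)) sattau => y yphi; rewrite /sigma.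
    by case: eqP => // E; rewrite -E yphi in xphi.
  apply/sat_lits=> -[y c] yc; rewrite /sigma /=; case: eqP => [E|_].
    by rewrite E in yc; rewrite (xlits c).
  exact: (lstau _ yc).
by move/satc_lit; rewrite /sigma eqxx; case: b {ent lNls sigma}.
Qed.

Theorem theorem7 :
  exists c : nat,
  forall (phixor : xorf) (n : nat) (t : rel 'I_n) (X : 'I_n -> {fset var})
         (al : {fset var} -> var) (phi : nat -> xorf),
    tree_decomposition (vars phixor) (primal_edge phixor) t X ->
    phi 0 = phixor ->
    (forall i : 'I_n, exists2 psi : xorf,
       ptable al (X i) (phi i) #|` X i| psi & phi i.+1 = phi i `|` psi) ->
    GE_simulation phixor (phi n `\` phixor) /\
    #|` phi n `\` phixor|
      <= c * (n * 2 ^ (2 * \max_(i < n) #|` X i|)) + #|` phixor|.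
Proof.
(* The constant is the one of the count for a single bag. *)
exists 4 => phixor n t X al phi tdX phi0 /chain_spec[]; rewrite phi0.
move=> [sub ext] tab le; split; last first.
  rewrite (leq_trans (fsubset_leq_card (fsubsetDl _ _))) //.
  by rewrite addnC mulnCA.
have defPhi : phixor `|` (phi n `\` phixor) = phi n.
  apply/fsetP=> C; rewrite !inE; case: (boolP (C \in phixor)) => //=.
  by move/(fsubsetP sub)->.
have model ls r tau Z : ~ up (phi n `|` lits ls) falsum -> Z `<=` X r ->
    (forall S p, S `<=` Z -> known al (phi n `|` lits ls) S p ->
       parity tau S = p) ->
    exists2 sigma, sat sigma (phixor `|` lits ls) & {in Z, sigma =1 tau}.
  move=> cons; apply: (known_model tdX cons); last exact: fsubsetUr.
    exact: fsubset_trans (fsubsetUl _ _).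
  by move=> i; apply: tabulated_sub (tab i); rewrite ?fsubsetUl.
have refute ls : ~ satisfiable (phixor `|` lits ls) ->
    up (phi n `|` lits ls) falsum.
  move=> unsat; apply: NNPP => cons.
  have [r _] : exists r : 'I_n, r \in 'I_n.
    by case: tdX => -[/card_gt0P].
  (* Nothing is prescribed here: over the empty set the only known equation is the trivial one. *)
  have [||tau sattau _] := model ls r (fun=> false) fset0 cons.
  - exact: fsub0set.
  - by move=> S p; rewrite fsubset0 /known => /eqP->; rewrite eqxx parity0.
  by apply: unsat; exists tau.
split; rewrite defPhi.
- move=> tau; split=> [/ext[sigma]|[sigma [satsigma E]]]; first by exists sigma.
  apply: (sat_eq E) => C Cphi; apply: satsigma; exact: (fsubsetP sub).
- move=> _ ls [x b] satls ent /=.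
  case: (boolP (x \in vars phixor)) => [xphi|xNphi]; last first.
    apply/up_premise; rewrite inE mem_lits.
    by rewrite (entails_foreign (l := (x, b)) xNphi satls ent) orbT.
  (* Literals on variables outside phixor may contradict the alias
     definitions, so only the others are kept as assumptions. *)
  pose ls' := [seq l <- ls | l.1 \in vars phixor].
  have subls : phi n `|` lits ls' `<=` phi n `|` lits ls.
    apply: fsetUS; apply/fsubsetP=> C /imfsetP[l /=].
    rewrite mem_filter => /andP[_ lls] ->.
    by rewrite mem_lits -surjective_pairing.
  apply: (up_mono subls); apply: NNPP => nup.
  (* A model of [phixor] and the kept literals extends to [phi n] without changing the variables of
     [phixor], so soundness excludes a conflict. *)
  have cons : ~ up (phi n `|` lits ls') falsum.
    case: satls => tau /satU[/ext[sigma satsigma E] /sat_lits lstau].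
    move=> /(up_sound _)/falsum_unsat; apply; apply/satU.
    split; first exact: satsigma.
    apply/sat_lits=> l; rewrite mem_filter => /andP[lphi lls].
    by rewrite E ?lstau.
  have [r _ xr] : exists2 r, true & x \in X r.
    by case: tdX xphi => _ -> _ _ /bigfcupP[r _ xr]; exists r.
  (* The prescribed value falsifies the literal. It could only violate a known equation on [x] alone
     stating that very literal, which by assumption is not derived. *)
  have [||tau sattau taux] := model ls' r (fun=> ~~ b) [fset x] cons.
  + by rewrite fsub1set.
  + move=> S p; rewrite fsubset1 => /orP[] /eqP->; last first.
      by rewrite /known eqxx parity0.
    have tabF i : tabulated al (X i) phixor (phi n `|` lits ls').
      by apply: tabulated_sub (tab i); rewrite ?fsubsetUl.
    rewrite parity1 => /(known1 tdX tabF _ xphi) ux.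
    by case: p b ux nup {ent} => [] [].
  case: satls => tau0 /satU[_ /sat_lits lstau0].
  move: sattau => /satU[sattau /sat_lits lstau].
  (* Taking the values of [tau0] outside [phixor] restores the dropped assumptions, so that [rho]
     satisfies all premises but not the entailed literal. *)
  pose rho y := if y \in vars phixor then tau y else tau0 y.
  have /satc_lit : satc rho (lit x b).
    apply: ent; apply/satU; split.
      by apply: (sat_eq (tau := tau)) sattau => y yphi; rewrite /rho yphi.
    apply/sat_lits=> l lls; rewrite /rho.
    case: ifP => [lphi|_]; last exact: lstau0.
    by apply: lstau; rewrite mem_filter lphi.
  by rewrite /rho xphi taux ?inE //; case: (b).
- by move=> _ ls; apply: refute.
- move=> unsat; have: up (phi n `|` lits [::]) falsum.
    apply: refute => -[tau /satU[sattau _]]; apply: unsat; by exists tau.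
  apply: up_mono; rewrite fsubUset fsubset_refl /=.
  by apply/fsubsetP=> C /imfsetP[].
Qed.
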